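(* Let $M\subset K$ be number fields, and let $\mathcal{O}$ be either the ring of integers $\mathbb{Z}_K$ of $K$ or an order in $\mathbb{Z}_K$, such that $\mathcal{O}$ has a relative integral basis over $M$. If $\alpha$ generates a power integral basis of $\mathcal{O}$, then $\alpha$ generates a relative power integral basis of $\mathcal{O}$ over $M$.
   Context: $\mathbb{Z}_K$ and $\mathbb{Z}_M$ denote the rings of integers of $K$ and $M$. A relative integral basis of $\mathcal{O}$ over $M$ is a basis of $\mathcal{O}$ as a free $\mathbb{Z}_M$-module (so in particular $\mathbb{Z}_M\subseteq\mathcal{O}$). An element $\alpha\in\mathcal{O}$ generates a power integral basis of $\mathcal{O}$ if $\mathcal{O}=\mathbb{Z}[\alpha]$; it generates a relative power integral basis of $\mathcal{O}$ over $M$ if $\mathcal{O}=\mathbb{Z}_M[\alpha]$. *)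

(* Defs.v *)
From HB Require Import structures.
From mathcomp Require Import all_boot all_order all_algebra all_field.
From mathcomp Require Import boolp.
Set Implicit Arguments. Unset Strict Implicit. Unset Printing Implicit Defensive.
Import GRing.Theory.
Local Open Scope ring_scope.

(* A number field is [K : fieldExtType rat]; its subfields are the            *)
(* [M : {subfield K}]. Arbitrary subsets of [K] are encoded as [{pred K}], via   *)
(* the classical [`[< _ >]].                                                     *)

Section NumberField.
Variable K : fieldExtType rat.

Definition rational_integers : {pred K} :=
  fun x => `[< exists n : int, x = n%:~R >].

Definition ring_of_integers (M : {subfield K}) : {pred K} :=
  fun x => (x \in M) && `[< integralOver (intr : int -> K) x >].

(* [b] is a basis of [S] as a free module over the subring [A]. The equivalence  *)
(* also says that [S] is stable under addition and under scaling by [A].         *)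
Definition module_basis (A S : {pred K}) (n : nat) (b : n.-tuple K) : Prop :=
  (forall x, x \in S <->
     exists c : 'I_n -> K,
       (forall i, c i \in A) /\ x = \sum_(i < n) c i * tnth b i) /\
  (forall c : 'I_n -> K, (forall i, c i \in A) ->
     \sum_(i < n) c i * tnth b i = 0 -> forall i, c i = 0).

(* An order is a subring with 1 that is free over the integers of full rank      *)
(* [K : Q].                                                                      *)
Definition is_order (O : {pred K}) : Prop :=
  [/\ subring_closed O,
      {subset O <= ring_of_integers {:K}%AS}
    & exists b : (\dim {:K}).-tuple K, module_basis rational_integers O b].

Definition has_relative_integral_basis (M : {subfield K}) (O : {pred K}) : Prop :=
  exists (n : nat) (b : n.-tuple K), module_basis (ring_of_integers M) O b.

Definition ring_adjoin (A : {pred K}) (alpha : K) : {pred K} :=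
  fun x => `[< exists2 p : {poly K}, p \is a polyOver A & x = p.[alpha] >].

Definition generates_power_integral_basis (O : {pred K}) (alpha : K) : Prop :=
  alpha \in O /\ O =i ring_adjoin rational_integers alpha.

Definition generates_relative_power_integral_basis
    (M : {subfield K}) (O : {pred K}) (alpha : K) : Prop :=
  alpha \in O /\ O =i ring_adjoin (ring_of_integers M) alpha.

End NumberField.

(* Main.v *)
Require Import Defs.
From HB Require Import structures.
From mathcomp Require Import all_boot all_order all_algebra all_field.
From mathcomp Require Import boolp.
Set Implicit Arguments. Unset Strict Implicit. Unset Printing Implicit Defensive.
Import GRing.Theory.
Local Open Scope ring_scope.

(** Write Z_M for the ring of integers of M. The inclusion of
    O = Z[alpha] in Z_M[alpha] only needs that Z is contained in Z_M
    ([rational_integers_sub]). Conversely, an element of Z_M[alpha] is a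
    Z_M-linear combination of powers of alpha; those powers lie in
    Z[alpha] = O, and O, being spanned by a relative integral basis, is a
    Z_M-submodule of K, so that it contains the combination
    ([module_basis_sum]). The last point rests on Z_M being a ring, which
    comes from the closure of integral elements under ring operations
    ([ring_of_integers_subring]). *)

Lemma rational_integers_subring (K : fieldExtType rat) :
  subring_closed (@rational_integers K).
Proof.
split; first by apply/asboolP; exists 1.
- move=> _ _ /asboolP[m ->] /asboolP[n ->].
  by apply/asboolP; exists (m - n); rewrite rmorphB.
- move=> _ _ /asboolP[m ->] /asboolP[n ->].
  by apply/asboolP; exists (m * n); rewrite rmorphM.
Qed.

HB.instance Definition _ (K : fieldExtType rat) :=
  GRing.isSubringClosed.Build K (@rational_integers K)
    (@rational_integers_subring K).

Lemma ring_of_integers_subring (K : fieldExtType rat) (M : {subfield K}) :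
  subring_closed (ring_of_integers M).
Proof.
split.
- by apply/andP; split; [exact: mem1v | apply/asboolP; exact: integral1].
- move=> x y /andP[xM /asboolP xI] /andP[yM /asboolP yI].
  by apply/andP; split; [exact: memvB | apply/asboolP; exact: integral_sub].
- move=> x y /andP[xM /asboolP xI] /andP[yM /asboolP yI].
  by apply/andP; split; [exact: memvM | apply/asboolP; exact: integral_mul].
Qed.

HB.instance Definition _ (K : fieldExtType rat) (M : {subfield K}) :=
  GRing.isSubringClosed.Build K (ring_of_integers M)
    (ring_of_integers_subring M).

(** Both sides are subrings, and Z is the smallest subring of K. *)
Lemma rational_integers_sub (K : fieldExtType rat) (M : {subfield K}) :
  {subset @rational_integers K <= ring_of_integers M}.
Proof. by move=> _ /asboolP[n ->]; exact: rpred_int. Qed.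

Lemma ring_adjoinS (K : fieldExtType rat) (A B : {pred K}) (x : K) :
  {subset A <= B} -> {subset ring_adjoin A x <= ring_adjoin B x}.
Proof.
move=> sAB y /asboolP[p pA ->]; apply/asboolP; exists p => //.
exact: polyOverS pA.
Qed.

Lemma ring_adjoinX (K : fieldExtType rat) (A : subringClosed K) (x : K) i :
  x ^+ i \in ring_adjoin A x.
Proof.
by apply/asboolP; exists 'X^i; [exact: polyOverXn | rewrite hornerXn].
Qed.

(** The span of a basis with coefficients in a subring [A] is a submodule:
    sums act on coordinates, and so does scaling by [A], which keeps the
    coordinates in [A] because [A] is closed under products. *)
Lemma module_basis_sum (K : fieldExtType rat) (A : subringClosed K)
    (S : {pred K}) (n : nat) (b : n.-tuple K) (I : finType) (a x : I -> K) :
  module_basis A S b -> (forall i, a i \in A) -> (forall i, x i \in S) ->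
  \sum_i a i * x i \in S.
Proof.
move=> [memS _] aA xS.
apply: (big_ind (fun y => y \in S)) => [|_ _ /memS[c [cA ->]] /memS[d [dA ->]]|i _].
- apply/memS; exists (fun=> 0); split=> [i|]; first exact: rpred0.
  by rewrite big1 // => i _; rewrite mul0r.
- apply/memS; exists (fun i => c i + d i); split=> [i|]; first exact: rpredD.
  by rewrite -big_split; apply: eq_bigr => i _; rewrite mulrDl.
- have /memS[c [cA ->]] := xS i.
  apply/memS; exists (fun j => a i * c j); split=> [j|]; first exact: rpredM.
  by rewrite mulr_sumr; apply: eq_bigr => j _; rewrite mulrA.
Qed.

Theorem corollary2 (K : fieldExtType rat) (M : {subfield K}) (O : {pred K})
    (alpha : K)
    (hO : O =i ring_of_integers {:K}%AS \/ is_order O)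
    (hbasis : has_relative_integral_basis M O)
    (halpha : generates_power_integral_basis O alpha) :
  generates_relative_power_integral_basis M O alpha.
Proof.
have [alphaO OE] := halpha; split=> // x; apply/idP/idP.
  by rewrite OE; apply: ring_adjoinS; exact: rational_integers_sub.
case: hbasis => n [b basis_b] /asboolP[p pM ->]; rewrite horner_coef.
apply: (module_basis_sum basis_b) => i; first exact: (polyOverP pM).
by rewrite OE; exact: ring_adjoinX.
Qed.
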